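(* Let $M$ be a smooth manifold of dimension $n\ge2$ with a Riemannian metric $\alpha=\sqrt{\alpha_{ij}(x)y^iy^j}$ and a $1$-form $\beta=b_i(x)y^i$, and let $F=\alpha\,(s^2-s-1)$, $s=\beta/\alpha$, be the golden $(\alpha,\beta)$-metric. Its fundamental metric tensor $g_{ij}=\frac12\frac{\partial^2F^2}{\partial y^i\partial y^j}$ is $$g_{ij}=(1+s+s^3-s^4)\,\alpha_{ij}+(6s^2-6s-1)\,b_ib_j+\frac{1+3s^2-4s^3}{\alpha}\Big(b_iy_j+b_jy_i-\frac{s}{\alpha}y_iy_j\Big),$$ the inverse of the fundamental metric tensor is $$g^{ij}=\frac{1}{1+s+s^3-s^4}\Big\{\alpha^{ij}+\eta\,b^ib^j+\eta_0\,\alpha^{-1}(b^iy^j+b^jy^i)+\frac{\eta_1}{\alpha^2}y^iy^j\Big\},$$ where $$\eta=\frac{-2}{2b^2-3s^2-1},\qquad \eta_0=-\frac{(s-1)(4s^2+s+1)}{(s^2-s-1)(-2b^2+3s^2+1)},$$ $$\eta_1=-\frac{(s-1)(4s^2+s+1)\big(b^2(1-2s)+s^3+s\big)}{(s^2-s-1)^2(-2b^2+3s^2+1)},$$ and its determinant is $$\det(g_{ij})=(-1)^{n-2}(s^2-s-1)^{n+1}(s^2+1)^{n-2}(2b^2-3s^2-1)\det(\alpha_{ij}).$$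
   Context: Notation: $(\alpha^{ij})$ is the inverse matrix of $(\alpha_{ij})$, $y_j=\alpha_{ij}y^i$, $b^i=\alpha^{ij}b_j$, and $b^2=\alpha^{ij}b_ib_j=\|\beta\|_\alpha^2$. All formulas are at points $(x,y)$ with $y\ne0$ where the golden metric is a Finsler metric, so in particular $s^2-s-1\neq0$ and $2b^2-3s^2-1\neq0$. *)

(* Defs.v *)
From HB Require Import structures.
From mathcomp Require Import all_boot all_order all_algebra.
From mathcomp Require Import all_classical all_reals all_analysis.

Set Implicit Arguments.
Unset Strict Implicit.
Unset Printing Implicit Defensive.
Import Order.TTheory GRing.Theory Num.Theory.
Import numFieldNormedType.Exports.
Local Open Scope classical_set_scope.
Local Open Scope ring_scope.

(* Meant for open [U]: being differentiable with all directional derivatives of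
   class C^k is then the usual notion of class C^(k+1), since the domain is
   finite-dimensional. *)
Fixpoint Ck_on (R : realType) (n : nat) (W : normedModType R) (k : nat)
    (U : set 'rV[R]_n) (f : 'rV[R]_n -> W) : Prop :=
  if k is k'.+1 then
    (forall u, U u -> differentiable f u) /\ (forall v, Ck_on k' U ('D_v f))
  else forall u, U u -> {for u, continuous f}.

Definition smooth_on (R : realType) (n : nat) (W : normedModType R)
    (U : set 'rV[R]_n) (f : 'rV[R]_n -> W) : Prop :=
  forall k, Ck_on k U f.

(* [chart_map] and [chart_inv] are total functions; only their values on
   [chart_dom] and on its image are meaningful. *)
Record chart (R : realType) (n : nat) (M : topologicalType) := Chart {
  chart_dom : set M;
  chart_map : M -> 'rV[R]_n;
  chart_inv : 'rV[R]_n -> M;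
  chart_dom_open : open chart_dom;
  chart_im_open : open (chart_map @` chart_dom);
  chart_mapK : forall x, chart_dom x -> chart_inv (chart_map x) = x;
  chart_map_continuous :
    forall x, chart_dom x -> {for x, continuous chart_map};
  chart_inv_continuous :
    forall u, (chart_map @` chart_dom) u -> {for u, continuous chart_inv}
}.

Definition transition (R : realType) (n : nat) (M : topologicalType)
    (c d : chart R n M) : 'rV[R]_n -> 'rV[R]_n :=
  chart_map d \o chart_inv c.

Record smooth_manifold (R : realType) (n : nat) := SmoothManifold {
  carrier :> topologicalType;
  atlas : set (chart R n carrier);
  manifold_hausdorff : hausdorff_space carrier;
  manifold_second_countable : @second_countable carrier;
  atlas_cover : forall x : carrier, exists2 c, atlas c & chart_dom c x;
  atlas_compatible : forall c d, atlas c -> atlas d ->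
    smooth_on (chart_map c @` (chart_dom c `&` chart_dom d)) (transition c d)
}.

(* Tensor fields are given by their components in the charts of the atlas.
   Vectors are rows and ['J f u] acts on the right ('d f u v = v *m 'J f u),
   which fixes the shape of the change-of-chart rules below. *)
Record riemannian_metric (R : realType) (n : nat) (M : smooth_manifold R n) :=
  RiemannianMetric {
  metric_coef : chart R n M -> M -> 'M[R]_n;
  metric_sym : forall c x, atlas c -> chart_dom c x ->
    (metric_coef c x)^T = metric_coef c x;
  metric_pos : forall c x, atlas c -> chart_dom c x ->
    forall v : 'rV[R]_n, v != 0 ->
    0 < \sum_(i < n) \sum_(j < n) metric_coef c x i j * v 0 i * v 0 j;
  metric_smooth : forall c, atlas c ->
    smooth_on (chart_map c @` chart_dom c) (metric_coef c \o chart_inv c);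
  metric_change : forall c d x, atlas c -> atlas d ->
    chart_dom c x -> chart_dom d x ->
    let J := jacobian (transition c d) (chart_map c x) in
    metric_coef c x = J *m metric_coef d x *m J^T
}.

Record one_form (R : realType) (n : nat) (M : smooth_manifold R n) := OneForm {
  form_coef : chart R n M -> M -> 'rV[R]_n;
  form_smooth : forall c, atlas c ->
    smooth_on (chart_map c @` chart_dom c) (form_coef c \o chart_inv c);
  form_change : forall c d x, atlas c -> atlas d ->
    chart_dom c x -> chart_dom d x ->
    let J := jacobian (transition c d) (chart_map c x) in
    form_coef c x = form_coef d x *m J^T
}.

(* Below, [a] and [b] are the components (alpha_ij) and (b_i) at one point of
   the manifold, and [y] those of a tangent vector there, in a common chart. *)
Section Pointwise.
Variables (R : realType) (n : nat).
Implicit Types (a : 'M[R]_n) (b y : 'rV[R]_n).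

Definition alpha_norm a y : R :=
  Num.sqrt (\sum_(i < n) \sum_(j < n) a i j * y 0 i * y 0 j).

Definition beta_form b y : R := \sum_(i < n) b 0 i * y 0 i.

Definition slope a b y : R := beta_form b y / alpha_norm a y.

Definition golden a b y : R :=
  alpha_norm a y * (slope a b y ^+ 2 - slope a b y - 1).

Definition lower a y (j : 'I_n) : R := \sum_(i < n) a i j * y 0 i.

Definition raise a b (i : 'I_n) : R := \sum_(j < n) invmx a i j * b 0 j.

Definition form_norm2 a b : R :=
  \sum_(i < n) \sum_(j < n) invmx a i j * b 0 i * b 0 j.

Definition fundamental_tensor (F : 'rV[R]_n -> R) y : 'M[R]_n :=
  \matrix_(i < n, j < n)
    (2^-1 * 'D_(delta_mx 0 i) ('D_(delta_mx 0 j) (fun z => F z ^+ 2)) y).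

End Pointwise.

(* Main.v *)
(* Differentiating [F^2] twice gives the stated tensor, which has the form
   [g = rho a + U^T C U] with [C] a 2 x 2 matrix, [rho = -(s^2 - s - 1)(s^2 + 1)]
   and [U] the 2 x n matrix with rows [b] and [(y_j / alpha)_j].  The Gram matrix
   [P = U a^-1 U^T] is [b2, s; s, 1].  Hence the matrix determinant lemma reduces
   [det g] to the 2 x 2 determinant of [1 + rho^-1 P C], and
   [rho^-1 (a^-1 + a^-1 U^T E U a^-1)] is inverse to [g] as soon as the 2 x 2
   identity [C + rho E + C P E = 0] holds, which the entries [eta], [eta0],
   [eta1] of [E] satisfy. *)
Require Import Defs.
From HB Require Import structures.
From mathcomp Require Import all_boot all_order all_algebra.
From mathcomp Require Import all_classical all_reals all_analysis.
From mathcomp Require Import ring zify.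

Set Implicit Arguments.
Unset Strict Implicit.
Unset Printing Implicit Defensive.
Import Order.TTheory GRing.Theory Num.Theory.
Import numFieldNormedType.Exports.
Local Open Scope classical_set_scope.
Local Open Scope ring_scope.

(** * Directional derivatives of alpha, beta and s *)

(** The two difference quotients are the same function of [h]. Restricting to a line makes the
    one-variable chain rule available for directional derivatives. *)
Lemma is_derive_line (R : realType) (V : normedModType R) (f : V -> R)
    (x v : V) (df : R) :
  is_derive x v f df <-> is_derive (0 : R) 1 (fun h : R => f (h *: v + x)) df.
Proof.
have E : (fun h : R => h^-1 *: ((f \o shift x) (h *: v) - f x)) =
  (fun h : R => h^-1 *: (((fun h : R => f (h *: v + x)) \o shift 0) (h *: 1)
     - f (0 *: v + x))).
  by apply/funext => h /=; rewrite scale0r add0r addr0 [h *: 1]mulr1.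
by split=> -[]; rewrite /derivable /derive ?E -?E => cf <-; split;
  rewrite /derivable /derive ?E -?E.
Qed.

Lemma is_derive_comp (R : realType) (V : normedModType R) (f : R -> R)
    (g : V -> R) (x v : V) (df dg : R) :
  is_derive (g x) 1 f df -> is_derive x v g dg ->
  is_derive x v (f \o g) (df * dg).
Proof.
move=> ff /is_derive_line fg; apply/is_derive_line.
by apply: is_derive1_comp; rewrite scale0r add0r.
Qed.

Lemma is_derive_coord (R : realType) (n : nat) (x v : 'rV[R]_n) (i : 'I_n) :
  is_derive x v (fun z : 'rV[R]_n => z 0 i : R) (v 0 i).
Proof.
apply/is_derive_line.
have -> : (fun h : R => (h *: v + x) 0 i) =
    (fun h : R => v 0 i *: h) + cst (x 0 i).
  by apply/funext => h; rewrite fctE !mxE mulrC.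
by apply: is_derive_eq; rewrite addr0 [_ *: _]mulr1.
Qed.

Lemma is_derive_beta_form (R : realType) (n : nat) (b x v : 'rV[R]_n) :
  is_derive x v (beta_form b) (beta_form b v).
Proof.
rewrite [X in is_derive _ _ X _](_ : _ =
    \sum_(i < n) (b 0 i \*: (fun z : 'rV[R]_n => z 0 i : R))); last first.
  by apply/funext => z; rewrite /beta_form fct_sumE.
by apply: is_derive_sum => i; apply: is_deriveZ; apply: is_derive_coord.
Qed.

(** The radicand of [alpha_norm] and also the quantity that [metric_pos] makes positive. *)
Definition quad_form (R : realType) (n : nat) (a : 'M[R]_n) (z : 'rV[R]_n) : R :=
  \sum_(i < n) \sum_(j < n) a i j * z 0 i * z 0 j.

(** The product rule gives two double sums, which the symmetry of [a] makes equal; hence the factor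
    2. *)
Lemma is_derive_quad_form (R : realType) (n : nat) (a : 'M[R]_n)
    (x v : 'rV[R]_n) :
  a^T = a ->
  is_derive x v (quad_form a) (2 * \sum_(j < n) lower a x j * v 0 j).
Proof.
move=> sa.
pose X i := (fun z : 'rV[R]_n => z 0 i : R).
have -> : quad_form a =
    \sum_(i < n) \sum_(j < n) (a i j \*: (X i * X j)).
  apply/funext => z; rewrite /quad_form fct_sumE; apply: eq_bigr => i _.
  by rewrite fct_sumE; apply: eq_bigr => j _; rewrite -mulrA.
apply: is_derive_eq.
  apply: is_derive_sum => i; apply: is_derive_sum => j; apply: is_deriveZ.
  by apply: is_deriveM; apply: is_derive_coord.
under eq_bigr do under eq_bigr do rewrite scalerDr.
under eq_bigr do rewrite big_split /=.
rewrite big_split /= mulr_natl mulr2n; congr (_ + _).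
  rewrite exchange_big /=; apply: eq_bigr => j _.
  by rewrite /lower mulr_suml; apply: eq_bigr => i _; rewrite [LHS]mulrA.
apply: eq_bigr => i _; rewrite /lower mulr_suml; apply: eq_bigr => j _.
by rewrite [LHS]mulrA -[in LHS]sa mxE.
Qed.

Lemma sum_delta (R : realType) (n : nat) (f : 'I_n -> R) (j : 'I_n) :
  \sum_(i < n) f i * (delta_mx 0 j : 'rV[R]_n) 0 i = f j.
Proof.
rewrite (bigD1 j) //= mxE !eqxx mulr1 big1 ?addr0 // => i ij.
by rewrite mxE (negbTE ij) mulr0.
Qed.

Lemma is_derive_alpha_norm (R : realType) (n : nat) (a : 'M[R]_n)
    (x : 'rV[R]_n) (j : 'I_n) :
  a^T = a -> 0 < quad_form a x ->
  is_derive x (delta_mx 0 j) (alpha_norm a) (lower a x j / alpha_norm a x).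
Proof.
move=> sa q0.
apply: (is_derive_eq (is_derive_comp (is_derive1_sqrt q0)
  (is_derive_quad_form _ _ sa))).
rewrite sum_delta /alpha_norm -/(quad_form a x).
have : Num.sqrt (quad_form a x) != 0 by rewrite gt_eqF // sqrtr_gt0.
by move: (Num.sqrt _) => t t0; field.
Qed.

Lemma is_derive_slope (R : realType) (n : nat) (a : 'M[R]_n)
    (b x : 'rV[R]_n) (j : 'I_n) :
  a^T = a -> 0 < quad_form a x ->
  is_derive x (delta_mx 0 j) (slope a b)
    ((b 0 j - slope a b x * lower a x j / alpha_norm a x) / alpha_norm a x).
Proof.
move=> sa q0; have A0 : alpha_norm a x != 0 by rewrite gt_eqF // sqrtr_gt0.
have dA := is_derive_alpha_norm j sa q0.
have dB := is_derive_beta_form b x (delta_mx 0 j).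
have dV : is_derive x (delta_mx 0 j) (fun z => (alpha_norm a z)^-1)
    (- alpha_norm a x ^- 2 *: (lower a x j / alpha_norm a x)).
  by split; [apply: derivableV => //; case: dA | rewrite deriveV // derive_val].
apply: (is_derive_eq (is_deriveM dB dV)).
rewrite {2}/beta_form sum_delta /slope /GRing.scale /=.
by field.
Qed.

(** * First and second derivatives of the squared golden metric *)

Section GoldenTensor.
Variables (R : realType) (n : nat) (a : 'M[R]_n) (b : 'rV[R]_n).
Hypothesis a_sym : a^T = a.
Hypothesis a_pos : forall v : 'rV[R]_n, v != 0 -> 0 < quad_form a v.

(** With phi = s^2 - s - 1, the two polynomials are phi (phi - s phi') and phi phi'. *)
Lemma derive_golden_sqr (y : 'rV[R]_n) (j : 'I_n) : y != 0 ->
  let s := slope a b y in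
  'D_(delta_mx 0 j) (fun z => golden a b z ^+ 2) y =
  2 * ((1 + s + s ^+ 3 - s ^+ 4) * lower a y j
       + alpha_norm a y * (2 * s ^+ 3 - 3 * s ^+ 2 - s + 1) * b 0 j).
Proof.
move=> y0 /=; have q0 := a_pos y0.
have A0 : alpha_norm a y != 0 by rewrite gt_eqF // sqrtr_gt0.
have dA := is_derive_alpha_norm j a_sym q0.
have dS := is_derive_slope b j a_sym q0.
have -> : (fun z => golden a b z ^+ 2) =
    (alpha_norm a * (slope a b ^+ 2 - slope a b - cst 1)) ^+ 2 by [].
rewrite derive_val /GRing.scale /= !fctE.
by field.
Qed.

(** Here 6 s^2 - 6 s - 1 = (phi phi')', while 1 + 3 s^2 - 4 s^3 is both the derivative of 1 + s +
    s^3 - s^4 and phi phi' - s (phi phi')', which makes the mixed terms symmetric. *)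
Lemma fundamental_tensor_golden (y : 'rV[R]_n) (i j : 'I_n) : y != 0 ->
  let al := alpha_norm a y in
  let s := slope a b y in
  fundamental_tensor (golden a b) y i j =
    (1 + s + s ^+ 3 - s ^+ 4) * a i j
    + (6 * s ^+ 2 - 6 * s - 1) * b 0 i * b 0 j
    + (1 + 3 * s ^+ 2 - 4 * s ^+ 3) / al *
      (b 0 i * lower a y j + b 0 j * lower a y i
       - s / al * lower a y i * lower a y j).
Proof.
move=> y0 /=; have q0 := a_pos y0.
have A0 : alpha_norm a y != 0 by rewrite gt_eqF // sqrtr_gt0.
have dA := is_derive_alpha_norm i a_sym q0.
have dS := is_derive_slope b i a_sym q0.
have dL : is_derive y (delta_mx 0 i) (fun z => lower a z j) (a i j).
  have -> : (fun z => lower a z j) = beta_form (col j a)^T.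
    by apply/funext => z; apply: eq_bigr => k _; rewrite !mxE.
  apply: (is_derive_eq (is_derive_beta_form _ _ _)).
  by rewrite /beta_form sum_delta !mxE.
(* The first derivative is known only off the origin; that this is an open condition lets its
   formula be differentiated again at [y]. *)
have near0 : \near y, y != 0.
  by apply: (@cvgr_neq0 _ _ _ (nbhs y) _ id y) => //; exact: cvg_id.
rewrite mxE.
pose S := slope a b.
rewrite (near_eq_derive _ (g := cst 2 *
    ((cst 1 + S + S ^+ 3 - S ^+ 4) * (fun z => lower a z j)
     + cst (b 0 j) *
       (alpha_norm a * (cst 2 * S ^+ 3 - cst 3 * S ^+ 2 - S + cst 1))))); last first.
  near=> z; rewrite derive_golden_sqr; last by near: z; exact: near0.
  rewrite !fctE /S /GRing.scale /=; ring.
rewrite derive_val /S /GRing.scale /= !fctE.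
by field.
Unshelve. all: by end_near. Qed.

End GoldenTensor.

(** * Determinant lemma and algebra of 2 x 2 matrices *)

(* Both sides compute the determinant of the block matrix [1, -V; U, a]. *)
Lemma det_add_mulmx (R : comUnitRingType) (n k : nat) (a : 'M[R]_n)
    (U : 'M[R]_(n, k)) (V : 'M[R]_(k, n)) : a \in unitmx ->
  \det (a + U *m V) = \det a * \det (1%:M + V *m invmx a *m U).
Proof.
move=> au.
have E1 : block_mx 1%:M (- V) U a =
    block_mx 1%:M 0 U 1%:M *m block_mx 1%:M (- V) 0 (a + U *m V).
  rewrite mulmx_block !mul1mx !mul0mx !mulmx1 ?mulmx0 !addr0.
  by rewrite mulmxN addrC addrK.
have E2 : block_mx 1%:M (- V) U a =
    block_mx (1%:M + V *m invmx a *m U) (- V) 0 a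
    *m block_mx 1%:M 0 (invmx a *m U) 1%:M.
  rewrite mulmx_block !mulmx1 ?mulmx0 ?mul0mx !add0r mulNmx.
  by rewrite mulmxA addrK mulKVmx.
have := congr1 determinant E2; rewrite E1 !det_mulmx !det_lblock !det_ublock.
by rewrite !det1 !mul1r !mulr1 mulrC.
Qed.

(** Scalar blocks of size [1 + 1] let products with [col_mx u v], for two rows [u] and [v], reduce
    blockwise. *)
Definition mx2 (R : pzRingType) (x y z w : R) : 'M[R]_(1 + 1) :=
  block_mx x%:M y%:M z%:M w%:M.

Lemma det_mx22 (R : comPzRingType) (M : 'M[R]_(1 + 1)) :
  \det M = M 0 0 * M 1 1 - M 0 1 * M 1 0.
Proof.
rewrite (expand_det_row _ 0) !big_ord_recl big_ord0 /cofactor !det_mx11 !mxE.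
have -> : lift 0 0 = 1 :> 'I_(1 + 1) by apply: val_inj.
have -> : lift 1 0 = 0 :> 'I_(1 + 1) by apply: val_inj.
by rewrite /=; ring.
Qed.

Lemma det_mx2 (R : comPzRingType) (x y z w : R) :
  \det (mx2 x y z w) = x * w - y * z.
Proof.
have o0 : 0 = lshift 1 0 :> 'I_(1 + 1) by apply: val_inj.
have o1 : 1 = rshift 1 0 :> 'I_(1 + 1) by apply: val_inj.
by rewrite det_mx22 o0 o1 block_mxEul block_mxEur block_mxEdl block_mxEdr !mxE.
Qed.

Lemma mx2D (R : pzRingType) (x y z w x' y' z' w' : R) :
  mx2 x y z w + mx2 x' y' z' w' = mx2 (x + x') (y + y') (z + z') (w + w').
Proof. by rewrite /mx2 add_block_mx -!raddfD. Qed.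

Lemma mx2Z (R : pzRingType) (c x y z w : R) :
  c *: mx2 x y z w = mx2 (c * x) (c * y) (c * z) (c * w).
Proof. by rewrite /mx2 scale_block_mx !scale_scalar_mx. Qed.

Lemma mx2M (R : pzRingType) (x y z w x' y' z' w' : R) :
  mx2 x y z w *m mx2 x' y' z' w' =
  mx2 (x * x' + y * z') (x * y' + y * w') (z * x' + w * z') (z * y' + w * w').
Proof. by rewrite /mx2 mulmx_block -!scalar_mxM -!raddfD. Qed.

Lemma mx2_scalar (R : pzRingType) (c : R) : c%:M = mx2 c 0 0 c.
Proof. by rewrite scalar_mx_block /mx2 !raddf0. Qed.

Lemma mx2_0 (R : pzRingType) : mx2 0 0 0 0 = 0 :> 'M[R]_(1 + 1).
Proof. by rewrite -mx2_scalar raddf0. Qed.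

(** * Determinant and inverse of a low-rank update *)

Section LowRankUpdate.
Variables (F : fieldType) (n k : nat) (a : 'M[F]_n) (U : 'M[F]_(k, n)).
Variables (C : 'M[F]_k) (r : F).
Hypotheses (au : a \in unitmx) (r0 : r != 0).
Let P := U *m invmx a *m U^T.

Lemma det_update :
  \det (r *: a + U^T *m C *m U) = r ^+ n * \det a * \det (1%:M + r^-1 *: (P *m C)).
Proof.
have ru : r *: a \in unitmx by rewrite unitmxZ ?unitfE.
rewrite det_add_mulmx // detZ invmxZ //; congr (_ * \det (_ + _)).
by rewrite -scalemxAr -scalemxAl mulmxA.
Qed.

(** Multiplied out, the product differs from the identity by r^-1 U^T (C + r E + C P E) U a^-1. *)
Lemma mulmx_update (E : 'M[F]_k) : C + r *: E + C *m P *m E = 0 ->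
  (r *: a + U^T *m C *m U) *m
  (r^-1 *: (invmx a + invmx a *m U^T *m E *m U *m invmx a)) = 1%:M.
Proof.
move=> CE.
have D : r *: (U^T *m E *m U *m invmx a) + U^T *m C *m U *m
    (invmx a + invmx a *m U^T *m E *m U *m invmx a) = 0.
  transitivity (U^T *m (C + r *: E + C *m P *m E) *m (U *m invmx a)).
    rewrite mulmxDr [in RHS]mulmxDr [in RHS]mulmxDr !mulmxDl.
    by rewrite -scalemxAr -scalemxAl /P !mulmxA addrCA addrA.
  by rewrite CE mulmx0 mul0mx.
rewrite -scalemxAr mulmxDl -scalemxAl mulmxDr !mulmxA mulmxV // mul1mx.
by rewrite [r *: (_ + _)]scalerDr -addrA D addr0 scalerA mulVf // scale1r.
Qed.

End LowRankUpdate.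

(** Serves twice: with rows b_i and y_i / alpha for the tensor, and with rows b^i and y^i / alpha
    for its inverse. *)
Lemma col_mx_update (F : fieldType) (n : nat) (u v : 'rV[F]_n) (x y z w : F) i j :
  ((col_mx u v)^T *m mx2 x y z w *m col_mx u v) i j =
  x * u 0 i * u 0 j + y * u 0 i * v 0 j + z * v 0 i * u 0 j + w * v 0 i * v 0 j.
Proof.
rewrite tr_col_mx mul_row_block mul_row_col !mul_mx_scalar !mulmxDl -!scalemxAl.
by rewrite !mxE !big_ord1 !mxE; ring.
Qed.

(** * Matrix form of the metric data and the Gram matrix *)

Lemma lowerE (R : realType) (n : nat) (a : 'M[R]_n) (y : 'rV[R]_n) j :
  lower a y j = (y *m a) 0 j.
Proof. by rewrite mxE; apply: eq_bigr => i _; rewrite mulrC. Qed.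

Lemma quad_formE (R : realType) (n : nat) (a : 'M[R]_n) (v : 'rV[R]_n) :
  quad_form a v = (v *m a *m v^T) 0 0.
Proof.
rewrite mxE /quad_form exchange_big /=; apply: eq_bigr => j _.
by rewrite !mxE mulr_suml; apply: eq_bigr => i _; rewrite [a i j * _]mulrC.
Qed.

Lemma beta_formE (R : realType) (n : nat) (b y : 'rV[R]_n) :
  beta_form b y = (b *m y^T) 0 0.
Proof. by rewrite mxE; apply: eq_bigr => i _; rewrite !mxE. Qed.

(** A nonzero row [v] with v a = 0 would give v a v^T = 0, against positivity. *)
Lemma posdef_unitmx (R : realType) (n : nat) (a : 'M[R]_n) :
  (forall v : 'rV[R]_n, v != 0 -> 0 < quad_form a v) -> a \in unitmx.
Proof.
move=> a_pos; rewrite -row_free_unit -kermx_eq0; apply/eqP/row_matrixP => i.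
rewrite row0; apply/eqP; apply: contraT => /a_pos; rewrite quad_formE.
by rewrite -row_mul mulmx_ker row0 mul0mx mxE ltxx.
Qed.

(** Since l a^-1 = y / alpha, the mixed entries are b y^T / alpha = s and the last one is y a y^T /
    alpha^2 = 1. *)
Lemma gram_golden (R : realType) (n : nat) (a : 'M[R]_n) (b y : 'rV[R]_n) :
  a^T = a -> (forall v : 'rV[R]_n, v != 0 -> 0 < quad_form a v) -> y != 0 ->
  let l := (alpha_norm a y)^-1 *: (y *m a) in
  col_mx b l *m invmx a *m (col_mx b l)^T =
  mx2 (form_norm2 a b) (slope a b y) (slope a b y) 1.
Proof.
move=> a_sym a_pos y0 /=; have au := posdef_unitmx a_pos.
have A0 : alpha_norm a y != 0 by rewrite gt_eqF // sqrtr_gt0 a_pos.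
have A2 : alpha_norm a y ^+ 2 = quad_form a y by rewrite sqr_sqrtr // ltW // a_pos.
have yb : y *m b^T = b *m y^T.
  by rewrite [RHS]mx11_scalar -tr_scalar_mx -mx11_scalar trmx_mul trmxK.
rewrite mul_col_mx tr_col_mx mul_col_row /mx2 linearZ /=.
rewrite -!scalemxAl -!scalemxAr mulmxK //.
rewrite trmx_mul a_sym mulmxA mulmxKV // yb mulmxA.
rewrite [b *m y^T]mx11_scalar [b *m _ *m _]mx11_scalar [y *m _ *m _]mx11_scalar.
rewrite -!quad_formE -!beta_formE -A2 !scale_scalar_mx /slope.
by congr block_mx; congr (_%:M) => //; field.
Qed.

Theorem proposition2p3 (R : realType) (n : nat) (hn : (2 <= n)%N)
    (M : smooth_manifold R n) (alpha : riemannian_metric M) (beta : one_form M)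
    (c : chart R n M) (hc : atlas c) (x : M) (hx : chart_dom c x)
    (y : 'rV[R]_n) (hy : y != 0) :
  let a := metric_coef alpha c x in
  let b := form_coef beta c x in
  let al := alpha_norm a y in
  let s := slope a b y in
  let b2 := form_norm2 a b in
  let g := fundamental_tensor (golden a b) y in
  let eta := - 2 / (2 * b2 - 3 * s ^+ 2 - 1) in
  let eta0 := - ((s - 1) * (4 * s ^+ 2 + s + 1) /
      ((s ^+ 2 - s - 1) * (- 2 * b2 + 3 * s ^+ 2 + 1))) in
  let eta1 := - ((s - 1) * (4 * s ^+ 2 + s + 1) *
        (b2 * (1 - 2 * s) + s ^+ 3 + s) /
      ((s ^+ 2 - s - 1) ^+ 2 * (- 2 * b2 + 3 * s ^+ 2 + 1))) in
  s ^+ 2 - s - 1 != 0 ->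
  2 * b2 - 3 * s ^+ 2 - 1 != 0 ->
  [/\ forall i j : 'I_n,
        g i j = (1 + s + s ^+ 3 - s ^+ 4) * a i j
              + (6 * s ^+ 2 - 6 * s - 1) * b 0 i * b 0 j
              + (1 + 3 * s ^+ 2 - 4 * s ^+ 3) / al *
                (b 0 i * lower a y j + b 0 j * lower a y i
                 - s / al * lower a y i * lower a y j),
      g \in unitmx,
      forall i j : 'I_n,
        invmx g i j = 1 / (1 + s + s ^+ 3 - s ^+ 4) *
          (invmx a i j + eta * raise a b i * raise a b j
           + eta0 * al^-1 * (raise a b i * y 0 j + raise a b j * y 0 i)
           + eta1 / al ^+ 2 * y 0 i * y 0 j)
    & \det g = (- 1) ^+ (n - 2) * (s ^+ 2 - s - 1) ^+ n.+1 *
               (s ^+ 2 + 1) ^+ (n - 2) * (2 * b2 - 3 * s ^+ 2 - 1) * \det a].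
Proof.
move=> a b al s b2 g eta eta0 eta1 phi0 den0.
have sa : a^T = a by exact: (Defs.metric_sym alpha hc hx).
have pa : forall v : 'rV[R]_n, v != 0 -> 0 < quad_form a v.
  by exact: (Defs.metric_pos alpha hc hx).
have au := posdef_unitmx pa.
have al0 : al != 0 by rewrite gt_eqF // sqrtr_gt0 pa.
have gE : forall i j, g i j = _ :=
  fun i j => fundamental_tensor_golden b sa pa i j hy.
pose rho := 1 + s + s ^+ 3 - s ^+ 4.
(* The factor -1 is kept apart because its power becomes the sign in the determinant. *)
have rhoE : rho = -1 * ((s ^+ 2 - s - 1) * (s ^+ 2 + 1)) by rewrite /rho; ring.
have s1 : s ^+ 2 + 1 != 0 by rewrite gt_eqF // ltr_wpDl // sqr_ge0.
have rho0 : rho != 0 by rewrite rhoE mulN1r oppr_eq0 mulf_neq0.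
have den0' : - 2 * b2 + 3 * s ^+ 2 + 1 != 0.
  rewrite -oppr_eq0.
  by have -> : - (- 2 * b2 + 3 * s ^+ 2 + 1) = 2 * b2 - 3 * s ^+ 2 - 1 by ring.
pose r1 := 1 + 3 * s ^+ 2 - 4 * s ^+ 3.
(* [C] and [E] collect the coefficients of the claimed formulas with respect to b_i, y_i / alpha and
   to b^i, y^i / alpha; each y thus absorbs one factor 1 / alpha. *)
pose C := mx2 (6 * s ^+ 2 - 6 * s - 1) r1 r1 (- (s * r1)).
pose E := mx2 eta eta0 eta0 eta1.
pose U := col_mx b (al^-1 *: (y *m a)).
have P : U *m invmx a *m U^T = mx2 b2 s s 1 by exact: gram_golden.
have lE k : (al^-1 *: (y *m a)) 0 k = al^-1 * lower a y k.
  by rewrite lowerE mxE.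
have gU : g = rho *: a + U^T *m C *m U.
  apply/matrixP => i j; rewrite gE [RHS]mxE col_mx_update !lE [(rho *: a) i j]mxE.
  by rewrite -/al -/s /rho /r1; field.
(* Four rational identities in [s] and [b2] alone. *)
have CE : C + rho *: E + C *m (U *m invmx a *m U^T) *m E = 0.
  rewrite P mx2Z !mx2M !mx2D -mx2_0.
  rewrite /eta /eta0 /eta1 /rho /r1.
  by congr mx2; field; rewrite ?den0 ?den0' ?phi0.
have gG := mulmx_update au rho0 CE; rewrite -gU in gG.
have gu : g \in unitmx by case/mulmx1_unit: gG.
split=> //.
  move=> i j.
  have -> : invmx g = rho^-1 *: (invmx a + invmx a *m U^T *m E *m U *m invmx a).
    by rewrite -[LHS]mulmx1 -gG mulKmx.
  (* The inverse metric raises the indices of both rows of [U]. *)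
  have UW : U *m invmx a = col_mx (\row_k raise a b k) (al^-1 *: y).
    rewrite mul_col_mx -scalemxAl mulmxK //; congr col_mx.
    apply/rowP => k; rewrite !mxE; apply: eq_bigr => l _.
    by rewrite mulrC -[in LHS]sa -trmx_inv mxE.
  have WU : invmx a *m U^T = (U *m invmx a)^T by rewrite trmx_mul trmx_inv sa.
  rewrite -(mulmxA _ U) WU UW [LHS]mxE [X in _ * X]mxE col_mx_update.
  rewrite ![(\row_k _) _ _]mxE ![(_ *: y) _ _]mxE -/rho div1r.
  by congr (_ * _); field.
rewrite gU det_update // P mx2M mx2Z mx2_scalar mx2D det_mx2 /r1.
(* As 2 <= n, splitting off the exponent [n - 2] leaves [rho ^+ 2] here and a cube below. What
   remains is that [rho ^+ 2] times the 2 x 2 determinant is (s^2 - s - 1)^3 (2 b2 - 3 s^2 - 1). *)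
have E1 : rho ^+ n = (- 1) ^+ (n - 2) *
    ((s ^+ 2 - s - 1) ^+ (n - 2) * (s ^+ 2 + 1) ^+ (n - 2)) * rho ^+ 2.
  by rewrite -!exprMn -rhoE -exprD subnK.
have E2 : (s ^+ 2 - s - 1) ^+ n.+1 =
    (s ^+ 2 - s - 1) ^+ (n - 2) * (s ^+ 2 - s - 1) ^+ 3.
  by rewrite -exprD; congr (_ ^+ _); lia.
rewrite E1 E2.
(* The powers depending on [n] become variables, so [field] meets only numeral exponents. *)
move: ((-1) ^+ (n - 2)) ((_ - 1) ^+ (n - 2)) ((_ + 1) ^+ (n - 2)) (\det a)
  => e p q d.
by move: rho0; rewrite /rho => rho0; field.
Qed.
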